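(* The knot complex $\mathrm{CFK}^{\infty}(T(5,7))$ is not stably equivalent to the knot complex $\mathrm{CFK}^{\infty}(T(2,5)\,\#\,T(5,6))$.
   Context: $T(p,q)\subset S^3$ denotes the torus knot for coprime $p,q\ge 2$, and $\#$ is connected sum of knots. $\mathbb F$ is the field with two elements. **Knot complexes.** For a knot $K\subset S^3$, $\mathrm{CFK}^\infty(K)$ is the Heegaard Floer knot complex of Ozsváth and Szabó. It is a finitely generated free chain complex over $\mathbb F[U,U^{-1}]$ with a Maslov grading, which the boundary map $\partial$ lowers by 1, and with two filtrations, the algebraic filtration $\mathrm{alg}$ and the Alexander filtration $\mathrm{Alex}$, neither of which is raised by $\partial$. Multiplication by $U$ lowers both filtration levels by 1 and the Maslov grading by 2. The complex is well defined up to bifiltered chain homotopy equivalence, denoted $\simeq$: grading-preserving, $\mathbb F[U,U^{-1}]$-linear chain maps respecting both filtrations, which are mutually inverse up to homotopies that also respect both filtrations. **Explicit models (standard facts).** Write the Alexander polynomial of a torus knot $K=T(p,q)$ as $\Delta_K(t)=\frac{(t^{pq}-1)(t-1)}{(t^p-1)(t^q-1)}=\sum_{i=0}^d(-1)^it^{a_i}$ with $0=a_0<a_1<\dots<a_d$ ($d$ even). Then $\mathrm{CFK}^\infty(K)$ is the staircase complex $[a_1-a_0,a_2-a_1,\dots,a_d-a_{d-1}]$. This is the complex freely generated over $\mathbb F[U,U^{-1}]$ by $x_0,\dots,x_d$, where: - $x_0$ has (alg, Alex) level $(0,a_d/2)$; - $x_{2i+1}$ has the level of $x_{2i}$ plus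 $(a_{2i+1}-a_{2i},0)$; - $x_{2i+2}$ has the level of $x_{2i+1}$ minus $(0,a_{2i+2}-a_{2i+1})$; - the even-indexed generators have Maslov grading 0 and the odd-indexed ones have Maslov grading 1; - $\partial x_{2i}=0$ and $\partial x_{2i+1}=x_{2i}+x_{2i+2}$. For knots $K,J$, $\mathrm{CFK}^\infty(K\,\#\,J)\simeq \mathrm{CFK}^\infty(K)\otimes_{\mathbb F[U,U^{-1}]}\mathrm{CFK}^\infty(J)$, where filtration levels and gradings add. **Stable equivalence.** $\mathrm{CFK}^\infty(K_1)$ and $\mathrm{CFK}^\infty(K_2)$ are called stably equivalent if there are acyclic complexes $A_1,A_2$ (graded, bifiltered complexes of the same type over $\mathbb F[U,U^{-1}]$ with zero homology) such that $\mathrm{CFK}^\infty(K_1)\oplus A_1\simeq \mathrm{CFK}^\infty(K_2)\oplus A_2$. *)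

(* Defs.v *)
From HB Require Import structures.
From mathcomp Require Import all_boot all_order all_algebra finmap zify.
From mathcomp.multinomials Require Import monalg.

Set Implicit Arguments.
Unset Strict Implicit.
Unset Printing Implicit Defensive.

Import Order.TTheory GRing.Theory Num.Theory.
Local Open Scope ring_scope.

(* [chain I] is the free F[U,U^-1]-module on the finite set I, F = 'F_2.      *)
(* It is realized as the F-vector space with basis I * int, where (i, k)      *)
(* stands for U^k x_i, with U acting as the automorphism [Uact 1]; an         *)
(* F[U,U^-1]-linear map is an F-linear map that commutes with [Uact 1].       *)
Notation chain I := {malg 'F_2[(I * int)%type]}.

Definition gen_chain (I : finType) (i : I) : chain I := << (i, 0) >>.

Section LinearExtension.
Variables (K : choiceType) (V : lmodType 'F_2) (g : K -> V).

Definition ext (c : {malg 'F_2[K]}) : V := \sum_(x <- msupp c) c@_x *: g x.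

Lemma extEw (d : {fset K}) (c : {malg 'F_2[K]}) :
  (msupp c `<=` d)%fset -> ext c = \sum_(x <- d) c@_x *: g x.
Proof.
move=> sub; rewrite /ext (big_fset_incl _ sub) // => x _ xn.
by rewrite mcoeff_outdom // scale0r.
Qed.

Lemma ext_is_linear : linear ext.
Proof.
move=> a u v; pose d := (msupp u `|` msupp v)%fset.
have su : (msupp u `<=` d)%fset by apply: fsubsetUl.
have sv : (msupp v `<=` d)%fset by apply: fsubsetUr.
have sw : (msupp (a *: u + v)%R `<=` d)%fset.
  apply: fsubset_trans (msuppD_le _ _) _.
  by rewrite fsubUset sv andbT (fsubset_trans (msuppZ_le _ _) su).
rewrite (extEw su) (extEw sv) (extEw sw) scaler_sumr -big_split /=.
by apply: eq_bigr => x _; rewrite mcoeffD mcoeffZ scalerDl scalerA.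
Qed.

HB.instance Definition _ :=
  GRing.isLinear.Build 'F_2 {malg 'F_2[K]} V _ ext ext_is_linear.

Lemma extU (x : K) : ext << x >> = g x.
Proof.
by rewrite /ext msuppU oner_eq0 big_seq_fset1 mcoeffUU scale1r.
Qed.

End LinearExtension.

Lemma ext_unique (K : choiceType) (V : lmodType 'F_2)
    (f h : {linear {malg 'F_2[K]} -> V}) :
  (forall x, f << x >> = h << x >>) -> f =1 h.
Proof.
move=> fh c; rewrite (monalgE c) !linear_sum /=.
apply: eq_bigr => x _.
have -> : << c@_x *g x >> = c@_x *: << x >> :> {malg 'F_2[K]}.
  by apply/malgP => y; rewrite mcoeffZ !mcoeffU mulr_natr.
by rewrite !linearZ /= fh.
Qed.

(* Multiplication by U^n. *)
Definition Uact (I : finType) (n : int) : chain I -> chain I :=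
  ext (fun x : I * int => << (x.1, x.2 + n) >>).
HB.instance Definition _ (I : finType) (n : int) :=
  GRing.Linear.on (@Uact I n).

(* The F[U,U^-1]-linear map that sends x_i to f i. *)
Definition Uext (I J : finType) (f : I -> chain J) : chain I -> chain J :=
  ext (fun x : I * int => Uact x.2 (f x.1)).
HB.instance Definition _ (I J : finType) (f : I -> chain J) :=
  GRing.Linear.on (Uext f).

Definition relabel (I J : finType) (h : I -> J) : chain I -> chain J :=
  Uext (fun i => gen_chain (h i)).
HB.instance Definition _ (I J : finType) (h : I -> J) :=
  GRing.Linear.on (relabel h).

(* A finitely generated free F[U,U^-1]-module with a basis that is            *)
(* homogeneous for the Maslov grading and adapted to both filtrations,        *)
(* together with the images of the basis under the boundary map.              *)
Record cdata := CData {
  gen : finType;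
  alg : gen -> int;
  alex : gen -> int;
  maslov : gen -> int;
  dgen : gen -> chain gen
}.

Definition bd (C : cdata) : chain (gen C) -> chain (gen C) := Uext (@dgen C).
HB.instance Definition _ (C : cdata) := GRing.Linear.on (@bd C).
Arguments bd {C}.

Definition alg_le (C : cdata) (a : int) (c : chain (gen C)) : Prop :=
  forall x, x \in msupp c -> alg x.1 - x.2 <= a.

Definition alex_le (C : cdata) (a : int) (c : chain (gen C)) : Prop :=
  forall x, x \in msupp c -> alex x.1 - x.2 <= a.

Definition maslov_homog (C : cdata) (m : int) (c : chain (gen C)) : Prop :=
  forall x, x \in msupp c -> maslov x.1 - x.2 *+ 2 = m.

Section Maps.
Variables C D : cdata.
Implicit Type f : chain (gen C) -> chain (gen D).

Definition U_equivariant f : Prop := forall c, f (Uact 1 c) = Uact 1 (f c).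

Definition respects_filtrations f : Prop :=
  (forall a c, alg_le a c -> alg_le a (f c)) /\
  (forall a c, alex_le a c -> alex_le a (f c)).

Definition has_degree (n : int) f : Prop :=
  forall m c, maslov_homog m c -> maslov_homog (m + n) (f c).

Definition bifiltered_map (n : int)
    (f : {linear chain (gen C) -> chain (gen D)}) : Prop :=
  [/\ U_equivariant f, respects_filtrations f & has_degree n f].

Definition chain_map (f : {linear chain (gen C) -> chain (gen D)}) : Prop :=
  bifiltered_map 0 f /\ forall c, f (bd c) = bd (f c).

Definition homotopic f g : Prop :=
  exists H : {linear chain (gen C) -> chain (gen D)},
    bifiltered_map 1 H /\ forall c, f c - g c = bd (H c) + H (bd c).

End Maps.

Record bfcomplex := BFComplex {
  cdata_of :> cdata;
  bd_bd : forall c : chain (gen cdata_of), bd (bd c) = 0;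
  bd_filtered : respects_filtrations (C := cdata_of) (D := cdata_of) bd;
  bd_degree : has_degree (C := cdata_of) (D := cdata_of) (-1) bd
}.

Definition acyclic (C : bfcomplex) : Prop :=
  forall c : chain (gen C), bd c = 0 -> exists b : chain (gen C), bd b = c.

Definition bf_equiv (C D : bfcomplex) : Prop :=
  exists (f : {linear chain (gen C) -> chain (gen D)})
         (g : {linear chain (gen D) -> chain (gen C)}),
    [/\ chain_map f, chain_map g,
        homotopic (C := C) (D := C) (g \o f) id &
        homotopic (C := D) (D := D) (f \o g) id].

Lemma UactU (I : finType) n (x : I * int) :
  Uact n << x >> = << (x.1, x.2 + n) >>.
Proof. exact: extU. Qed.

Lemma UextU (I J : finType) (f : I -> chain J) (x : I * int) :
  Uext f << x >> = Uact x.2 (f x.1).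
Proof. exact: extU. Qed.

Lemma UactD (I : finType) m n (c : chain I) : Uact m (Uact n c) = Uact (n + m) c.
Proof.
apply: (ext_unique (f := Uact m \o Uact n) (h := Uact (n + m))) => x /=.
by rewrite !UactU /= addrA.
Qed.

Lemma Uact0 (I : finType) (c : chain I) : Uact 0 c = c.
Proof.
apply: (ext_unique (f := Uact 0) (h := idfun)) => x /=.
by rewrite UactU addr0; case: x.
Qed.

Lemma Uext_gen (I J : finType) (f : I -> chain J) i : Uext f (gen_chain i) = f i.
Proof. by rewrite UextU Uact0. Qed.

Lemma Uext_Uact (I J : finType) (f : I -> chain J) n c :
  Uext f (Uact n c) = Uact n (Uext f c).
Proof.
apply: (ext_unique (f := Uext f \o Uact n) (h := Uact n \o Uext f)) => x /=.
by rewrite UactU !UextU UactD.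
Qed.

Lemma Uext_eq0 (I J : finType) (h : {linear chain I -> chain J}) :
  (forall n c, h (Uact n c) = Uact n (h c)) ->
  (forall i, h (gen_chain i) = 0) -> forall c, h c = 0.
Proof.
move=> hU h0.
apply: (ext_unique (f := h) (h := \0)) => -[i k] /=.
have -> : << (i, k) >> = Uact k (gen_chain i) by rewrite UactU /= add0r.
by rewrite hU h0 linear0.
Qed.

Lemma msupp_Uact (I : finType) n (c : chain I) y :
  y \in msupp (Uact n c) -> (y.1, y.2 - n) \in msupp c.
Proof.
rewrite -!mcoeff_neq0 /Uact /ext raddf_sum /=.
apply: contraNneq => y0; rewrite big_seq big1 // => x xc.
rewrite mcoeffZ mcoeffU; case: eqP => [xy|_]; last by rewrite mulr0n mulr0.
move: y0; rewrite -xy /= addrK; case: x {xy} xc => i k xc /= ->.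
by rewrite mul0r.
Qed.

Lemma msupp_Uext (I J : finType) (f : I -> chain J) (c : chain I) y :
  y \in msupp (Uext f c) ->
  exists2 x, x \in msupp c & (y.1, y.2 - x.2) \in msupp (f x.1).
Proof.
rewrite -mcoeff_neq0 /Uext /ext raddf_sum /= => y0.
have [/hasP[x xc xy]|/hasPn N] :=
  boolP (has (fun x => (y.1, y.2 - x.2) \in msupp (f x.1)) (msupp c)).
  by exists x.
case/eqP: y0; rewrite big_seq big1 // => x /N xy.
rewrite mcoeffZ [X in _ * X]mcoeff_outdom ?mulr0 //.
by apply: contraNN xy; apply: msupp_Uact.
Qed.

Lemma msupp_relabel (I J : finType) (h : I -> J) (c : chain I) y :
  y \in msupp (relabel h c) -> exists2 x, x \in msupp c & y = (h x.1, x.2).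
Proof.
case/msupp_Uext => x xc; rewrite msuppU oner_eq0 in_fset1 => /eqP[yh yx].
exists x => //; case: y yh yx => y1 y2 /= -> /eqP.
by rewrite subr_eq0 => /eqP ->.
Qed.

Lemma eq_Uext (I J : finType) (f g : I -> chain J) :
  f =1 g -> Uext f =1 Uext g.
Proof. by move=> fg c; apply: eq_bigr => x _; rewrite fg. Qed.

Lemma UextDf (I J : finType) (f g : I -> chain J) c :
  Uext (fun i => f i + g i) c = Uext f c + Uext g c.
Proof.
rewrite /Uext /ext -big_split; apply: eq_bigr => x _ /=.
by rewrite linearD scalerDr.
Qed.

Lemma Uext_relabel (I J K : finType) (f : J -> chain K) (h : I -> J) c :
  Uext f (relabel h c) = Uext (f \o h) c.
Proof.
apply: (ext_unique (f := Uext f \o relabel h) (h := Uext (f \o h))) => x /=.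
by rewrite /relabel UextU Uext_Uact Uext_gen UextU.
Qed.

Lemma relabel_Uext (I J K : finType) (h : J -> K) (f : I -> chain J) c :
  relabel h (Uext f c) = Uext (fun i => relabel h (f i)) c.
Proof.
apply: (ext_unique (f := relabel h \o Uext f)
  (h := Uext (fun i => relabel h (f i)))) => x /=.
by rewrite !UextU /relabel Uext_Uact.
Qed.

Lemma levels_trans (a b k l m : int) :
  a - (k - l) <= b -> b - l <= m -> a - k <= m.
Proof. lia. Qed.

Lemma degrees_trans (a b k l : int) :
  a - (k - l) *+ 2 = b - 1 -> a - k *+ 2 = b - l *+ 2 - 1.
Proof. lia. Qed.

Section GeneratorAxioms.
Variable C : cdata.

Lemma bd_bd_gen :
  (forall i : gen C, bd (dgen i) = 0) -> forall c : chain (gen C), bd (bd c) = 0.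
Proof.
move=> H; apply: (Uext_eq0 (h := @bd C \o @bd C)) => [n c|i] /=.
  by rewrite /(@bd C) !Uext_Uact.
by rewrite [bd (gen_chain i)]Uext_gen H.
Qed.

Lemma bd_filtered_gen :
  (forall (i : gen C) x, x \in msupp (dgen i) ->
     (alg x.1 - x.2 <= alg i) && (alex x.1 - x.2 <= alex i)) ->
  respects_filtrations (C := C) (D := C) bd.
Proof.
move=> H; split=> a c Hc y /msupp_Uext[x /Hc xa /H /andP[/= H1 H2]].
  exact: (levels_trans H1 xa).
exact: (levels_trans H2 xa).
Qed.

Lemma bd_degree_gen :
  (forall (i : gen C) x, x \in msupp (dgen i) ->
     maslov x.1 - x.2 *+ 2 = maslov i - 1) ->
  has_degree (C := C) (D := C) (-1) bd.
Proof.
move=> H m c Hc y /msupp_Uext[x /Hc <- /H /= E].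
exact: degrees_trans E.
Qed.

Lemma bd_gen (i : gen C) : bd (gen_chain i) = dgen i.
Proof. exact: Uext_gen. Qed.

Lemma msupp_gen (i : gen C) x : x \in msupp (gen_chain i) -> x = (i, 0).
Proof. by rewrite msuppU oner_eq0 in_fset1 => /eqP. Qed.

End GeneratorAxioms.

Section ComplexOnGenerators.
Variable C : bfcomplex.

Lemma bd_dgen (i : gen C) : bd (dgen i) = 0.
Proof. by rewrite -bd_gen bd_bd. Qed.

Lemma dgen_filtered (i : gen C) x : x \in msupp (dgen i) ->
  (alg x.1 - x.2 <= alg i) && (alex x.1 - x.2 <= alex i).
Proof.
rewrite -bd_gen => xi; have [Ha Hx] := bd_filtered C.
by apply/andP; split; [apply: (Ha _ (gen_chain i)) | apply: (Hx _ (gen_chain i))];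
  rewrite // => y /msupp_gen -> /=; rewrite subr0.
Qed.

Lemma dgen_degree (i : gen C) x : x \in msupp (dgen i) ->
  maslov x.1 - x.2 *+ 2 = maslov i - 1.
Proof.
rewrite -bd_gen => xi; apply: (bd_degree (b := C) (c := gen_chain i)) => //.
by move=> y /msupp_gen -> /=; rewrite mul0rn subr0.
Qed.

End ComplexOnGenerators.

Definition dsum_data (C D : cdata) : cdata := @CData (gen C + gen D)%type
  (fun x => match x with inl i => alg i | inr j => alg j end)
  (fun x => match x with inl i => alex i | inr j => alex j end)
  (fun x => match x with inl i => maslov i | inr j => maslov j end)
  (fun x => match x with
            | inl i => relabel inl (dgen i)
            | inr j => relabel inr (dgen j)
            end).

Lemma bd_relabel (C D : cdata) (h : gen C -> gen D) :
  (forall i, dgen (h i) = relabel h (dgen i)) ->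
  forall c : chain (gen C), bd (relabel h c) = relabel h (bd c).
Proof.
by move=> H c; rewrite /(@bd C) /(@bd D) Uext_relabel relabel_Uext; apply: eq_Uext.
Qed.

Lemma Uact_relabel (I J : finType) (h : I -> J) k (b : chain I) :
  Uact k (relabel h b) =
  \sum_(y <- msupp b) b@_y *: (<< (h y.1, y.2 + k) >> : chain J).
Proof.
rewrite -[relabel h b]/(\sum_(y <- msupp b) b@_y *: Uact y.2 (gen_chain (h y.1))).
rewrite raddf_sum /=; apply: eq_bigr => y _.
by rewrite [LHS]linearZ /= UactD UactU /= add0r.
Qed.

Lemma cross_terms (I J K : finType) (h : I -> J -> K) (a : chain I) (b : chain J) :
  Uext (fun i => relabel (h i) b) a = Uext (fun j => relabel (h^~ j) a) b.
Proof.
transitivity (\sum_(x <- msupp a) \sum_(y <- msupp b)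
  (a@_x * b@_y) *: (<< (h x.1 y.1, x.2 + y.2) >> : chain K)).
  apply: eq_bigr => x _; rewrite Uact_relabel scaler_sumr.
  by apply: eq_bigr => y _; rewrite scalerA addrC.
rewrite exchange_big; apply: eq_bigr => y _; rewrite Uact_relabel scaler_sumr.
by apply: eq_bigr => x _; rewrite scalerA mulrC.
Qed.

Lemma addrr_F2 (V : lmodType 'F_2) (v : V) : v + v = 0.
Proof.
rewrite -mulr2n -scaler_nat (_ : 2%:R = 0 :> 'F_2) ?scale0r //.
exact/val_inj.
Qed.

Section DirectSum.
Variables C D : bfcomplex.
Let S := dsum_data C D.

Lemma dsum_bd_bd (c : chain (gen S)) : bd (bd c) = 0.
Proof.
apply: bd_bd_gen => {c} -[i|j] /=.
- rewrite (bd_relabel (D := S) (h := inl)) //.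
  by rewrite bd_dgen linear0.
- rewrite (bd_relabel (D := S) (h := inr)) //.
  by rewrite bd_dgen linear0.
Qed.

Lemma dsum_filtered : respects_filtrations (C := S) (D := S) bd.
Proof.
apply: bd_filtered_gen => -[i|j] _ /msupp_relabel[x xc ->] /=;
  exact: dgen_filtered.
Qed.

Lemma dsum_degree : has_degree (C := S) (D := S) (-1) bd.
Proof.
apply: bd_degree_gen => -[i|j] _ /msupp_relabel[x xc ->] /=;
  exact: dgen_degree.
Qed.

Definition dsum : bfcomplex := BFComplex dsum_bd_bd dsum_filtered dsum_degree.

End DirectSum.

(* The tensor product over F[U,U^-1], with boundary dx (x) y + x (x) dy (no   *)
(* signs over F); [tensor] of the complexes of K and J is that of K # J.      *)
Definition tensor_data (C D : cdata) : cdata := @CData (gen C * gen D)%type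
  (fun x => alg x.1 + alg x.2)
  (fun x => alex x.1 + alex x.2)
  (fun x => maslov x.1 + maslov x.2)
  (fun x => relabel (fun i => (i, x.2)) (dgen x.1) +
            relabel (fun j => (x.1, j)) (dgen x.2)).

Section Tensor.
Variables C D : bfcomplex.
Let T := tensor_data C D.

Lemma tensor_dgen_supp (x : gen T) y : y \in msupp (dgen x) ->
  (exists2 u, u \in msupp (dgen x.1) & y = ((u.1, x.2), u.2)) \/
  (exists2 v, v \in msupp (dgen x.2) & y = ((x.1, v.1), v.2)).
Proof.
move/(fsubsetP (msuppD_le _ _)); rewrite in_fsetU => /orP[]
  /msupp_relabel[u uc ->]; [left|right]; by exists u.
Qed.

Lemma tensor_bd_bd (c : chain (gen T)) : bd (bd c) = 0.
Proof.
apply: bd_bd_gen => {c} -[i j] /=; rewrite linearD /=.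
rewrite /(@bd T) !Uext_relabel /=.
have cross : Uext (fun i' => relabel (fun j' => (i', j')) (dgen j)) (dgen i) =
             Uext (fun j' => relabel (fun i' => (i', j')) (dgen i)) (dgen j).
  exact: cross_terms.
have E1 : Uext (fun i' => dgen (c := T) (i', j)) (dgen i) =
          relabel (fun i' => (i', j)) (bd (dgen i)) +
          Uext (fun i' => relabel (fun j' => (i', j')) (dgen j)) (dgen i).
  by rewrite UextDf /(@bd _) relabel_Uext.
have E2 : Uext (fun j' => dgen (c := T) (i, j')) (dgen j) =
          Uext (fun j' => relabel (fun i' => (i', j')) (dgen i)) (dgen j) +
          relabel (fun j' => (i, j')) (bd (dgen j)).
  by rewrite UextDf /(@bd _) relabel_Uext.
rewrite E1 E2 !bd_dgen !linear0 add0r addr0 cross.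
exact: addrr_F2.
Qed.

Lemma tensor_filtered : respects_filtrations (C := T) (D := T) bd.
Proof.
apply: bd_filtered_gen => -[i j] _ /tensor_dgen_supp[] [x /dgen_filtered + ->] /=.
- by rewrite ![_ + _ - _]addrAC !lerD2r.
- by rewrite -!addrA !lerD2l.
Qed.

Lemma tensor_degree : has_degree (C := T) (D := T) (-1) bd.
Proof.
apply: bd_degree_gen => -[i j] _ /tensor_dgen_supp[] [x /dgen_degree + ->] /=.
- by rewrite addrAC => ->; rewrite addrAC.
- by rewrite -!addrA => ->.
Qed.

Definition tensor : bfcomplex :=
  BFComplex tensor_bd_bd tensor_filtered tensor_degree.

End Tensor.

Definition stably_equivalent (C D : bfcomplex) : Prop :=
  exists A B : bfcomplex,
    [/\ acyclic A, acyclic B & bf_equiv (dsum C A) (dsum D B)].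

(* The staircase complex [s_1, ..., s_d], whose steps are the differences     *)
(* s_n = a_n - a_(n-1), so that a_d = sumn s.                                 *)
Definition stair_data (s : seq nat) : cdata := @CData 'I_(size s).+1
  (fun n => (\sum_(k < n | ~~ odd k) nth 0%N s k)%N%:Z)
  (fun n => (sumn s)./2%:Z - (\sum_(k < n | odd k) nth 0%N s k)%N%:Z)
  (fun n => (odd n)%:Z)
  (fun n => \sum_(m < (size s).+1 | odd n && ((m.+1 == n) || (m == n.+1 :> nat)))
              gen_chain m).

Lemma sum_cond_recr (P : pred nat) (F : nat -> nat) m :
  (\sum_(k < m.+1 | P k) F k =
   \sum_(k < m | P k) F k + (if P m then F m else 0))%N.
Proof. by rewrite big_mkcond big_ord_recr -big_mkcond. Qed.

Section Staircase.
Variable s : seq nat.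
Let S := stair_data s.

Lemma stair_dgen_supp (n : gen S) y : y \in msupp (dgen n) ->
  [/\ odd n, y.2 = 0 & (y.1.+1 == n) || (y.1 == n.+1 :> nat)].
Proof.
rewrite -mcoeff_neq0 raddf_sum /= => H.
have [m] : exists2 m : 'I_(size s).+1,
    odd n && ((m.+1 == n) || (m == n.+1 :> nat)) & (gen_chain m)@_y != 0.
  apply/exists_inP; apply: contraNT H => /exists_inPn H.
  by rewrite big1 // => m /H /negPn/eqP.
case/andP=> on nm; rewrite mcoeffU.
have [<- //|_] := eqVneq (m, 0 : int) y.
by rewrite mulr0n eqxx.
Qed.

Lemma stair_bd_bd (c : chain (gen S)) : bd (bd c) = 0.
Proof.
apply: bd_bd_gen => {c} n; rewrite linear_sum big1 // => m /andP[on nm].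
rewrite [LHS]bd_gen; apply: big1 => k /andP[om _].
by case/orP: nm om on => /eqP; [move=> <-|move=> ->] => /=; case: (odd _).
Qed.

Lemma stair_filtered : respects_filtrations (C := S) (D := S) bd.
Proof.
apply: bd_filtered_gen => n [m k] /stair_dgen_supp[/= on -> nm].
rewrite !subr0; case/orP: nm => /eqP E.
- rewrite -E (sum_cond_recr (fun k => ~~ odd k)) (sum_cond_recr odd) /=.
  rewrite -E /= in on; rewrite (negbTE on) /= addn0 lexx andbT.
  by rewrite lez_nat leq_addr.
- rewrite E (sum_cond_recr (fun k => ~~ odd k)) (sum_cond_recr odd) on /= addn0.
  by rewrite lexx lerD2l lerN2 lez_nat leq_addr.
Qed.

Lemma stair_degree : has_degree (C := S) (D := S) (-1) bd.
Proof.
apply: bd_degree_gen => n [m k] /stair_dgen_supp[/= on -> nm].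
rewrite on; case/orP: nm => /eqP E; last by rewrite E /= on.
by move: on; rewrite -E /= => /negbTE ->.
Qed.

Definition staircase : bfcomplex :=
  BFComplex stair_bd_bd stair_filtered stair_degree.

End Staircase.

(* Exact division in Z[t]: the denominator is monic and, for coprime p and q, *)
(* divides the numerator.                                                     *)
Definition torus_alexander (p q : nat) : {poly int} :=
  (('X^(p * q) - 1) * ('X - 1)) %/ (('X^p - 1) * ('X^q - 1)).

(* a_0 < a_1 < ... < a_d *)
Definition exponents (f : {poly int}) : seq nat :=
  [seq i <- iota 0 (size f) | f`_i != 0].

(* a_1 - a_0, ..., a_d - a_(d-1) *)
Definition gaps (a : seq nat) : seq nat :=
  pairmap (fun x y => y - x)%N (head 0%N a) (behead a).

(* CFK^oo (T(p,q)) for coprime p, q >= 2. *)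
Definition CFK_torus (p q : nat) : bfcomplex :=
  staircase (gaps (exponents (torus_alexander p q))).

(* Main.v *)
(* A homotopy equivalence between the stabilized complexes restricts to a     *)
(* bifiltered chain map h : C -> D that is injective on homology, where C is  *)
(* the staircase x_0, ..., x_16 of T(5,7) and D is the tensor product of the  *)
(* staircases y_0, ..., y_4 of T(2,5) and z_0, ..., z_8 of T(5,6). In their   *)
(* Maslov gradings, the only generator of D at or below the level (3,5) of    *)
(* x_6 is y_0 (x) z_4, the only one for x_4, at level (2,7), is y_2 (x) z_2,  *)
(* and the only one for x_5, at level (3,7), is y_3 (x) z_2. Hence            *)
(* h(x_6) = h(x_4) + d h(x_5) is a multiple of y_0 (x) z_4 and also involves  *)
(* only the z_2 column, so h(x_6) = 0. But x_6 is homologous to x_0, which    *)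
(* generates the homology of C in grading 0, a contradiction.                 *)

From HB Require Import structures.
From mathcomp Require Import all_boot all_order all_algebra finmap zify ring.
From mathcomp.multinomials Require Import monalg.
Require Import Defs.

Set Implicit Arguments.
Unset Strict Implicit.
Unset Printing Implicit Defensive.

Import Order.TTheory GRing.Theory Num.Theory.
Local Open Scope ring_scope.

(** The filtrations and the grading leave so little room in the target that the map [h] of
    [stable_equivalence_map] must kill x_6 ([image_x6]): the bounds on h(x_6) and those on h(x_4) +
    d h(x_5) allow no common generator. Then h(x_0) is a boundary ([image_x0_boundary]), hence so is
    x_0, which [augmentation_bd] excludes. *)

(** * Direct sums and stable equivalence *)

Section Projections.
Variables I J : finType.

Definition projl : chain (I + J)%type -> chain I :=
  Uext (fun x => if x is inl i then gen_chain i else 0).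
HB.instance Definition _ := GRing.Linear.on projl.

Definition projr : chain (I + J)%type -> chain J :=
  Uext (fun x => if x is inr j then gen_chain j else 0).
HB.instance Definition _ := GRing.Linear.on projr.

Lemma projl_inl c : projl (relabel inl c) = c.
Proof.
apply: (ext_unique (f := projl \o relabel inl) (h := idfun)) => -[i k] /=.
by rewrite /projl Uext_relabel UextU /= UactU /= add0r.
Qed.

Lemma projr_inr c : projr (relabel inr c) = c.
Proof.
apply: (ext_unique (f := projr \o relabel inr) (h := idfun)) => -[i k] /=.
by rewrite /projr Uext_relabel UextU /= UactU /= add0r.
Qed.

Lemma proj_sum c : c = relabel inl (projl c) + relabel inr (projr c).
Proof.
apply: (ext_unique (f := idfun)
  (h := (relabel inl \o projl) \+ (relabel inr \o projr))) => -[[i|j] k] /=.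
- rewrite /projl /projr !relabel_Uext !UextU /= !linear0 addr0.
  by rewrite /relabel Uext_gen UactU /= add0r.
- rewrite /projl /projr !relabel_Uext !UextU /= !linear0 add0r.
  by rewrite /relabel Uext_gen UactU /= add0r.
Qed.

Lemma msupp_projl c y : y \in msupp (projl c) -> (inl y.1, y.2) \in msupp c.
Proof.
case/msupp_Uext => -[[i|j] k] xc /=; last by rewrite msupp0 in_fset0.
rewrite msuppU oner_eq0 in_fset1; case: y => y1 y2 /eqP[-> /eqP].
by rewrite subr_eq0 => /eqP ->.
Qed.

End Projections.

Arguments projl {I J}.
Arguments projr {I J}.

Section DirectSumProjections.
Variables C D : bfcomplex.

Lemma bd_inl (c : chain (gen C)) :
  bd (C := dsum C D) (relabel inl c) = relabel inl (bd c).
Proof. exact: (bd_relabel (D := dsum C D)). Qed.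

Lemma bd_inr (c : chain (gen D)) :
  bd (C := dsum C D) (relabel inr c) = relabel inr (bd c).
Proof. exact: (bd_relabel (D := dsum C D)). Qed.

Lemma bd_projl (c : chain (gen (dsum C D))) : bd (projl c) = projl (bd c).
Proof.
rewrite [in RHS](proj_sum c) linearD /= bd_inl bd_inr linearD /= projl_inl.
rewrite [X in _ = _ + X](_ : _ = 0) ?addr0 //.
by rewrite /projl Uext_relabel; apply: big1 => x _; rewrite /= linear0 scaler0.
Qed.

Lemma bd_projr (c : chain (gen (dsum C D))) : bd (projr c) = projr (bd c).
Proof.
rewrite [in RHS](proj_sum c) linearD /= bd_inl bd_inr linearD /= projr_inr.
rewrite [X in _ = X + _](_ : _ = 0) ?add0r //.
by rewrite /projr Uext_relabel; apply: big1 => x _; rewrite /= linear0 scaler0.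
Qed.

End DirectSumProjections.

(* Acyclic summands carry no homology, so the component C -> D of a homotopy  *)
(* equivalence of the sums is still injective on homology.                    *)
Lemma stable_equivalence_map (C D : bfcomplex) : stably_equivalent C D ->
  exists h : {linear chain (gen C) -> chain (gen D)},
    [/\ respects_filtrations h, has_degree 0 h,
        forall c, h (bd c) = bd (h c) &
        forall z e, bd z = 0 -> h z = bd e -> exists b, bd b = z].
Proof.
case=> A [B [_ acB [f [g [[[_ [fa fx] fd] fbd] [_ gbd] [H [_ HH]] _]]]]].
exists (projl \o f \o relabel inl); split.
- split=> [a c|a c] Hc x /msupp_projl.
  + by apply: (fa a) => y /msupp_relabel[w wc ->]; apply: Hc.
  + by apply: (fx a) => y /msupp_relabel[w wc ->]; apply: Hc.
- move=> m c Hc x /msupp_projl.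
  by apply: (fd m) => y /msupp_relabel[w wc ->]; apply: Hc.
- by move=> c /=; rewrite -bd_inl fbd bd_projl.
move=> z e z0 /= hz.
have u0 : bd (C := dsum C A) (relabel inl z) = 0 by rewrite bd_inl z0 linear0.
(* The [B]-component of the cycle [f z] bounds by acyclicity, and its [D]-component is [bd e]. *)
have [b bE] : exists b, bd b = projr (f (relabel inl z)).
  by apply: acB; rewrite bd_projr -fbd u0 !linear0.
have fE : f (relabel inl z) = bd (C := dsum D B) (relabel inl e + relabel inr b).
  by rewrite linearD /= bd_inl bd_inr -hz bE -proj_sum.
(* The homotopy from [g \o f] to the identity pulls the bounding chain of [f z] back to one of
   [z]. *)
have uE : relabel inl z = bd (C := dsum C A)
    (g (relabel inl e + relabel inr b) - H (relabel inl z)).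
  rewrite linearB /= -gbd -fE.
  have := HH (relabel inl z); rewrite u0 linear0 addr0 /= => <-.
  by rewrite subKr.
exists (projl (g (relabel inl e + relabel inr b) - H (relabel inl z))).
by rewrite bd_projl -uE projl_inl.
Qed.

(** * Levels, boundary and homology of staircases *)

(** Stated with lists instead of big operators so that [vm_compute] can evaluate [low_gens]. *)
Definition seq_alg (s : seq nat) n : int :=
  (sumn [seq nth 0%N s k | k <- iota 0 n & ~~ odd k])%:Z.

Definition seq_alex (s : seq nat) n : int :=
  (sumn s)./2%:Z - (sumn [seq nth 0%N s k | k <- iota 0 n & odd k])%:Z.

Lemma sum_ord_sumn (P : pred nat) (F : nat -> nat) n :
  (\sum_(k < n | P k) F k)%N = sumn [seq F k | k <- iota 0 n & P k].
Proof. by rewrite sumnE big_map big_filter -big_mkord /index_iota subn0. Qed.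

Section Staircase.
Variable s : seq nat.
Notation S := (staircase s).

Lemma stair_alg (n : gen S) : alg n = seq_alg s n.
Proof. by rewrite /= (sum_ord_sumn (fun k => ~~ odd k)). Qed.

Lemma stair_alex (n : gen S) : alex n = seq_alex s n.
Proof. by rewrite /= (sum_ord_sumn odd). Qed.

Lemma stair_dgen_even (n : gen S) : ~~ odd n -> dgen n = 0.
Proof. by move=> /negbTE n0; apply: big1 => m; rewrite n0. Qed.

Lemma stair_dgen_odd (m n k : gen S) :
  odd n -> m.+1 = n -> k = n.+1 :> nat -> dgen n = gen_chain m + gen_chain k.
Proof.
move=> on mn kn.
rewrite /= (bigD1 m) /=; last by rewrite on mn eqxx.
rewrite (bigD1 k) /=; last first.
  by rewrite on kn eqxx orbT -val_eqE /= kn; apply/eqP; lia.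
congr (_ + _); rewrite big1; first exact: addr0.
move=> i /andP[/andP[/andP[_ H] /eqP im] /eqP ik].
have {}im : (i : nat) <> m by move/val_inj.
have {}ik : (i : nat) <> k by move/val_inj.
by case/orP: H => /eqP H; lia.
Qed.

Lemma bd_gen_odd (m n k : gen S) :
  odd n -> m.+1 = n -> k = n.+1 :> nat ->
  bd (gen_chain n) = gen_chain m + gen_chain k.
Proof. by rewrite bd_gen; apply: stair_dgen_odd. Qed.

(** Sets [U] to 1 and counts even generators modulo 2; it detects the homology class of x_0. *)
Definition augmentation : chain (gen S) -> ('F_2)^o :=
  ext (fun x : gen S * int => (~~ odd x.1)%:R).
HB.instance Definition _ := GRing.Linear.on augmentation.

Lemma augmentationU x : augmentation << x >> = (~~ odd x.1)%:R.
Proof. exact: extU. Qed.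

Lemma augmentation_Uact n c : augmentation (Uact n c) = augmentation c.
Proof.
apply: (ext_unique (f := augmentation \o Uact n) (h := augmentation)) => x /=.
by rewrite UactU [LHS]augmentationU [RHS]augmentationU.
Qed.

(** With an even number of steps no odd generator is at an end, so each has two even neighbours,
    which cancel modulo 2. *)
Lemma augmentation_dgen (n : gen S) :
  ~~ odd (size s) -> augmentation (dgen n) = 0.
Proof.
move=> ev.
have [on|en] := boolP (odd n); last by rewrite (stair_dgen_even en) linear0.
have n0 : (0 < n)%N by case: (nat_of_ord n) on.
have n1 : (n < size s)%N.
  by rewrite ltn_neqAle -ltnS ltn_ord andbT; apply: contraNneq ev => <-.
have mP : (n.-1 < (size s).+1)%N by lia.
have mn : (Ordinal mP).+1 = n by rewrite /= prednK.
rewrite (stair_dgen_odd (m := Ordinal mP) (k := @Ordinal (size s).+1 n.+1 n1)) //.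
rewrite linearD [X in X + _]augmentationU [X in _ + X]augmentationU /= negbK on.
have -> : odd n.-1 = false by apply: negbTE; rewrite -oddS prednK.
by rewrite addrr_F2.
Qed.

Lemma augmentation_bd c : ~~ odd (size s) -> augmentation (bd c) = 0.
Proof.
move=> ev.
apply: (ext_unique (f := augmentation \o bd) (h := \0)) => -[n k].
rewrite [LHS]/= [bd _]UextU augmentation_Uact.
exact: augmentation_dgen.
Qed.

End Staircase.

(** * Alexander polynomials of the three torus knots *)

(** Since the divisor is monic, a product identity certifies the quotient; [s] lists its
    coefficients from the constant term up, and the Horner form lets [ring] check the identity. *)
Lemma torus_alexander_eq p q s : (0 < p)%N -> (0 < q)%N -> last 1 s != 0 ->
  ('X^(p * q) - 1) * ('X - 1) =
    foldr (fun a P => P * 'X + a%:P) 0 s * (('X^p - 1) * ('X^q - 1)) ->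
  torus_alexander p q = s :> seq int.
Proof.
move=> p0 q0 s1 E.
have monic1 n : (0 < n)%N -> 'X^n - 1 \is @monic int.
  by move=> n0; apply: monicXnsubC.
rewrite /torus_alexander E Pdiv.IdomainMonic.mulpK ?monicMr ?monic1 //.
rewrite (_ : foldr _ _ s = Poly s) ?(PolyK s1) //.
by elim: s {E s1} => //= a s ->; rewrite -cons_poly_def.
Qed.

Definition gaps57 := [:: 1; 4; 1; 1; 1; 2; 1; 1; 1; 1; 2; 1; 1; 1; 4; 1]%N.
Definition gaps25 := [:: 1; 1; 1; 1]%N.
Definition gaps56 := [:: 1; 4; 2; 3; 3; 2; 4; 1]%N.

Lemma gaps_5_7 : gaps (exponents (torus_alexander 5 7)) = gaps57.
Proof.
rewrite /exponents (@torus_alexander_eq 5 7 [:: 1; -1; 0; 0; 0; 1; -1; 1; -1; 0;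
  1; -1; 1; -1; 1; 0; -1; 1; -1; 1; 0; 0; 0; -1; 1]) //=.
by rewrite !raddfN /=; ring.
Qed.

Lemma gaps_2_5 : gaps (exponents (torus_alexander 2 5)) = gaps25.
Proof.
rewrite /exponents (@torus_alexander_eq 2 5 [:: 1; -1; 1; -1; 1]) //=.
by rewrite !raddfN /=; ring.
Qed.

Lemma gaps_5_6 : gaps (exponents (torus_alexander 5 6)) = gaps56.
Proof.
rewrite /exponents (@torus_alexander_eq 5 6 [:: 1; -1; 0; 0; 0; 1; 0;
  -1; 0; 0; 1; 0; 0; -1; 0; 1; 0; 0; 0; -1; 1]) //=.
by rewrite !raddfN /=; ring.
Qed.

(** * The obstruction from levels and gradings *)

(* The pair (i, j) stands for U^k (y_i (x) z_j), where the Maslov grading m    *)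
(* forces k = 1 if i and j are both odd, and k = 0 otherwise.                 *)
Definition low_gens (s t : seq nat) (a x : int) (m : bool) : seq (nat * nat) :=
  [seq n <- [seq (i, j) | i <- iota 0 (size s).+1, j <- iota 0 (size t).+1] |
    let k : nat := odd n.1 && odd n.2 in
    [&& seq_alg s n.1 + seq_alg t n.2 - k%:Z <= a,
        seq_alex s n.1 + seq_alex t n.2 - k%:Z <= x & odd n.1 (+) odd n.2 == m]].

Lemma low_gensP s t a x (m : bool) c y :
  let D := tensor (staircase s) (staircase t) in
  alg_le (C := D) a c -> alex_le (C := D) x c -> maslov_homog (C := D) m%:Z c ->
  y \in msupp c -> (y.1.1 : nat, y.1.2 : nat) \in low_gens s t a x m.
Proof.
move=> D ac xc mc yc.
have := mc y yc; have := xc y yc; have := ac y yc.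
rewrite [alg _]/(alg y.1.1 + alg y.1.2) [alex _]/(alex y.1.1 + alex y.1.2).
rewrite !stair_alg !stair_alex [maslov _]/((odd y.1.1)%:Z + (odd y.1.2)%:Z).
case: y yc => -[i j] k _ /= ak xk mk.
have [kE mE] : k = (odd i && odd j : nat)%:Z /\ odd i (+) odd j = m.
  by move: mk; case: (odd i); case: (odd j); case: m {mc} => /=; split; lia.
rewrite mem_filter allpairs_f ?mem_iota ?add0n ?ltn_ord //.
by rewrite /= -kE ak xk mE eqxx.
Qed.

Lemma bd_telescope (C : cdata) (u v a b c : chain (gen C)) :
  bd u = a + b -> bd v = b + c -> bd (u + v) = a + c.
Proof. by rewrite linearD /= => -> ->; rewrite addrA -(addrA a) addrr_F2 addr0. Qed.

Section Obstruction.
Notation C := (staircase gaps57).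
Notation D := (tensor (staircase gaps25) (staircase gaps56)).
Variable h : {linear chain (gen C) -> chain (gen D)}.
Hypothesis h_filtered : respects_filtrations h.
Hypothesis h_degree : has_degree 0 h.
Hypothesis h_bd : forall c, h (bd c) = bd (h c).

Lemma image_gen_low (n : gen C) y : y \in msupp (h (gen_chain n)) ->
  (y.1.1 : nat, y.1.2 : nat) \in
    low_gens gaps25 gaps56 (seq_alg gaps57 n) (seq_alex gaps57 n) (odd n).
Proof.
have [ha hx] := h_filtered; apply: low_gensP.
- by apply: ha => x /msupp_gen ->; rewrite [leLHS]subr0 [alg _]stair_alg.
- by apply: hx => x /msupp_gen ->; rewrite [leLHS]subr0 [alex _]stair_alex.
- rewrite -[(odd n)%:Z]addr0; apply: h_degree => x /msupp_gen -> /=.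
  by rewrite mul0rn subr0.
Qed.

Let x n (lt_n : (n < 17)%N) : gen C := Ordinal lt_n.
Let x0 := @x 0 isT. Let x1 := @x 1 isT. Let x2 := @x 2 isT. Let x3 := @x 3 isT.
Let x4 := @x 4 isT. Let x5 := @x 5 isT. Let x6 := @x 6 isT.

Lemma image_x6 : h (gen_chain x6) = 0.
Proof.
have bd5 : bd (gen_chain x5) = gen_chain x4 + gen_chain x6.
  exact: bd_gen_odd.
have hE : h (gen_chain x6) = h (gen_chain x4) + bd (h (gen_chain x5)).
  by rewrite -h_bd bd5 linearD addrA addrr_F2 add0r.
apply/malgP => y; rewrite mcoeff0; apply/eqP.
rewrite -[_ == _]negbK mcoeff_neq0; apply/negP => y6; have := image_gen_low y6.
rewrite (_ : low_gens _ _ _ _ _ = [:: (0, 4)%N]); last by vm_compute.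
rewrite inE => /eqP[_ y4].
(* So [y] lies in the z_4 column; both summands of [hE] turn out to lie in the z_2 column. *)
move: y6; rewrite hE => /(fsubsetP (msuppD_le _ _)); rewrite in_fsetU => /orP[].
  move/image_gen_low.
  rewrite (_ : low_gens _ _ _ _ _ = [:: (2, 2)%N]); last by vm_compute.
  by rewrite inE y4 => /eqP.
case/msupp_Uext => z /image_gen_low.
rewrite (_ : low_gens _ _ _ _ _ = [:: (3, 2)%N]); last by vm_compute.
rewrite inE => /eqP[_ z2] /tensor_dgen_supp[] [u].
  by move=> _ [y1 _]; move: y4; rewrite y1 /= z2.
(* z_2 has even index, so its boundary is zero and the second factor contributes nothing. *)
by move=> uz _; have [] := stair_dgen_supp uz; rewrite z2.
Qed.

(** The boundary of x_1 + x_3 + x_5 telescopes to x_0 + x_6, and [h] kills x_6. *)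
Lemma image_x0_boundary : exists e, h (gen_chain x0) = bd e.
Proof.
have bd1 : bd (gen_chain x1) = gen_chain x0 + gen_chain x2 by exact: bd_gen_odd.
have bd3 : bd (gen_chain x3) = gen_chain x2 + gen_chain x4 by exact: bd_gen_odd.
have bd5 : bd (gen_chain x5) = gen_chain x4 + gen_chain x6 by exact: bd_gen_odd.
exists (h (gen_chain x1 + gen_chain x3 + gen_chain x5)).
rewrite -h_bd (bd_telescope (bd_telescope bd1 bd3) bd5) linearD.
by rewrite [X in _ + X]image_x6 addr0.
Qed.

End Obstruction.

Theorem theorem1p1 :
  ~ stably_equivalent (CFK_torus 5 7) (tensor (CFK_torus 2 5) (CFK_torus 5 6)).
Proof.
rewrite /CFK_torus gaps_5_7 gaps_2_5 gaps_5_6.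
case/stable_equivalence_map => h [h_filt h_deg h_bd h_inj].
have [e he] := image_x0_boundary h_filt h_deg h_bd.
have [|b bE] := h_inj _ _ _ he; first by rewrite bd_gen; apply: stair_dgen_even.
have := augmentation_bd b (isT : ~~ odd (size gaps57)).
by rewrite bE augmentationU => /eqP; rewrite oner_eq0.
Qed.
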